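(* Let $G$ be a finite chordal graph and let $r\geq 1$ be an integer with $r\leq \mu(G)/2$. Then for any cross-intersecting pair $(\mathcal{A},\mathcal{B})$ in $\mathcal{J}^r(G)$, we have $|\mathcal{A}|+|\mathcal{B}|\leq |\mathcal{J}^r(G)|$.
   Context: A graph is chordal if it has no induced cycle on more than $3$ vertices. For a graph $G$, $\mu(G)$ denotes the minimum size of a maximal (with respect to inclusion) independent set in $G$, and $\mathcal{J}^r(G)$ denotes the family of all independent vertex sets of size $r$ in $G$. A pair $(\mathcal{A},\mathcal{B})$ is a cross-intersecting pair in $\mathcal{J}^r(G)$ if $\mathcal{A},\mathcal{B}\subseteq\mathcal{J}^r(G)$ and $A\cap B\neq\emptyset$ for every $A\in\mathcal{A}$, $B\in\mathcal{B}$. *)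

(* Defs.v *)
From mathcomp Require Import all_boot.

Set Implicit Arguments.
Unset Strict Implicit.
Unset Printing Implicit Defensive.

(* A finite simple graph is a symmetric irreflexive relation e (adjacency)
   on a finType of vertices. *)
Section Graph.

Variables (T : finType) (e : rel T).

(* c lists the vertices in cyclic order; the second clause says that the cycle
   has no chord. It is only used with 3 < size c: for short sequences, e.g.
   [:: x; y] with x adjacent to y, ucycle e c holds without c being a cycle of
   the graph. *)
Definition induced_cycle (c : seq T) : Prop :=
  ucycle e c /\
  {in c &, forall x y, e x y -> (y == next c x) || (x == next c y)}.

Definition chordal : Prop :=
  forall c : seq T, 3 < size c -> ~ induced_cycle c.

Definition independent (A : {set T}) : bool :=
  [forall x in A, forall y in A, ~~ e x y].

(* The default value #|T| plays no role: a maximal independent set always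
   exists and has at most #|T| elements; see mu_witness and mu_le. *)
Definition mu : nat := \big[minn/#|T|]_(A : {set T} | maxset independent A) #|A|.

Definition indep_family (r : nat) : {set {set T}} :=
  [set A : {set T} | independent A & #|A| == r].

Definition cross_intersecting (r : nat) (FA FB : {set {set T}}) : Prop :=
  [/\ FA \subset indep_family r,
      FB \subset indep_family r
    & forall A B : {set T}, A \in FA -> B \in FB -> A :&: B != set0].

Lemma mu_le (A : {set T}) : maxset independent A -> mu <= #|A|.
Proof.
move=> maxA; rewrite /mu; have := mem_index_enum A.
elim: (index_enum _) => //= B s IHs; rewrite inE big_cons => /predU1P[<-|/IHs le_s].
  by rewrite maxA geq_minl.
by case: ifP => // _; rewrite geq_min le_s orbT.
Qed.

Lemma mu_witness : exists2 A : {set T}, maxset independent A & #|A| = mu.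
Proof.
have ind0 : independent set0 by apply/forall_inP => x; rewrite inE.
have [A0 maxA0 _] := maxset_exists ind0.
have [//|muT] : (exists2 A : {set T}, maxset independent A & #|A| = mu)
                \/ mu = #|T|.
  rewrite /mu; elim/big_ind: _ => [|m n IHm IHn|A maxA]; first by right.
    by rewrite /minn; case: ifP.
  by left; exists A.
exists A0 => //; apply/eqP.
by rewrite eqn_leq (mu_le maxA0) muT max_card.
Qed.

End Graph.

(* Main.v *)
Require Import Defs.
From mathcomp Require Import all_boot.

(* Every edge-containing induced subgraph of a chordal graph has an edge uv with
   N[u] included in N[v]: otherwise every edge xy extends to an induced path
   xyz, and following such extensions forever yields a long induced cycle.
   Shifting v to u keeps both families independent and cross-intersecting, and
   afterwards the members that contain v still meet once v is removed from
   them. Deleting v does not decrease mu, and deleting N[v] decreases it by at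
   most one, so induction applies to G - v with r and to G - N[v] with r - 1.
   For edgeless graphs the regularity of the Kneser graph gives the bound. *)

Set Implicit Arguments.
Unset Strict Implicit.
Unset Printing Implicit Defensive.

(** * Cross-intersecting families of [r]-subsets, without a graph *)

Section SetFamilies.

Variable T : finType.
Implicit Types (A B W : {set T}) (F FA FB : {set {set T}}).

Definition cross_meet FA FB :=
  forall A B, A \in FA -> B \in FB -> A :&: B != set0.

Lemma cross_meetC FA FB : cross_meet FA FB -> cross_meet FB FA.
Proof. by move=> meetAB A B BA BB; rewrite setIC meetAB. Qed.

(** Regularity of the Kneser graph: the sets counted are the [r]-subsets of [W :\: B]. *)
Lemma card_draws_disjoint W r B :
  B \subset W -> #|B| = r ->
  #|[set A : {set T} | [&& A \subset W, #|A| == r & [disjoint A & B]]]|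
    = 'C(#|W| - r, r).
Proof.
move=> BW <-; rewrite -(cardsDS BW) -cards_draws; apply: eq_card => A.
by rewrite !inE subsetD -!andbA [_ && [disjoint _ & _]]andbC.
Qed.

Lemma sum_nat_pred_card (X : finType) (S : {set X}) (P : pred X) :
  \sum_(x in S) P x = #|[set x in S | P x]|.
Proof.
rewrite -sum1dep_card big_mkcondr /=.
by apply: eq_bigr => x _; case: (P x).
Qed.

(* Double counting of the disjoint pairs. *)
Lemma cross_meet_draws W r FA FB :
  2 * r <= #|W| ->
  FA \subset [set A : {set T} | A \subset W & #|A| == r] ->
  FB \subset [set A : {set T} | A \subset W & #|A| == r] ->
  cross_meet FA FB ->
  #|FA| + #|FB| <= #|[set A : {set T} | A \subset W & #|A| == r]|.
Proof.
rewrite mul2n -addnn => leW.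
set J := finset _ => sFA sFB meetAB.
have D_gt0 : 0 < 'C(#|W| - r, r).
  by rewrite bin_gt0 leq_subRL // (leq_trans _ leW) ?leq_addr.
suff le_A : #|FA| <= #|J :\: FB|.
  by rewrite -(cardsID FB J) (setIidPr sFB) addnC leq_add2l.
rewrite -(leq_pmul2r D_gt0) -2!sum_nat_const.
(* No member of [FB] is disjoint from [A], so all Kneser neighbours of [A] lie in [J :\: FB]. *)
have -> : \sum_(A in FA) 'C(#|W| - r, r)
    = \sum_(A in FA) \sum_(B in J :\: FB) [disjoint B & A].
  apply: eq_bigr => A FAA; have := subsetP sFA A FAA.
  rewrite inE => /andP[AW /eqP cA]; rewrite -(card_draws_disjoint AW cA).
  rewrite sum_nat_pred_card; apply: eq_card => B; rewrite !inE -!andbA.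
  have [FBB|//] := boolP (B \in FB); apply/negP => /and3P[_ _].
  by rewrite disjoint_sym -setI_eq0 (negPf (meetAB _ _ FAA FBB)).
(* Seen from [B], the neighbours in [FA] are only some of all its neighbours. *)
rewrite exchange_big /=; apply: leq_sum => B.
rewrite !inE => /and3P[_ BW /eqP cB]; rewrite -(card_draws_disjoint BW cB).
rewrite sum_nat_pred_card; apply/subset_leq_card/subsetP => A.
rewrite !inE [[disjoint B & A]]disjoint_sym => /andP[/(subsetP sFA)].
by rewrite inE => /andP[-> ->] ->.
Qed.

End SetFamilies.

(** * Dominated edges in chordal graphs *)

Section ChordalCrossIntersecting.

Variables (T : finType) (e : rel T).
Hypotheses (e_sym : symmetric e) (e_irr : irreflexive e).
Implicit Types (u v x y : T) (A B I W : {set T}) (F FA FB : {set {set T}}).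

(* Take the least d >= 2 for which f i and f (i + d) are equal or adjacent
   for some i: then f i, ..., f (i + d) is an induced cycle. *)
Lemma chordal_no_long_walk (f : nat -> T) :
  chordal e ->
  (forall n, e (f n) (f n.+1)) ->
  (forall n, f n.+2 != f n) -> (forall n, ~~ e (f n) (f n.+2)) -> False.
Proof.
move=> chord f_e f_neq f_nadj.
have far d : 1 < d -> forall i, (f i != f (i + d)) && ~~ e (f i) (f (i + d)).
  elim/ltn_ind: d => d IHd d_gt1 i.
  have [d_le2|d_gt2] := leqP d 2.
    have -> : d = 2 by apply/eqP; rewrite eqn_leq d_le2.
    by rewrite addn2 eq_sym f_neq f_nadj.
  have dE : d = d.-1.+1 by rewrite prednK // (ltn_trans _ d_gt1).
  (* Equality would make [f i.+1] adjacent to [f (i + d)], a pair at distance [d.-1 > 1], against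
     the induction hypothesis. *)
  have fneq : f i != f (i + d).
    have ltd1 : d.-1 < d by rewrite [ltnRHS]dE.
    have d1_gt1 : 1 < d.-1 by rewrite -ltnS -dE.
    apply/eqP => fE; have /andP[_] := IHd _ ltd1 d1_gt1 i.+1.
    by rewrite addSnnS -dE -fE e_sym f_e.
  rewrite fneq; apply/negP => adj.
  pose g k := f (i + k); pose c := mkseq g d.+1.
  (* Only the two ends of the window are at distance [d]; every other nonconsecutive pair falls
     under the induction hypothesis. *)
  have g_far a b : a < b <= d -> (a != 0) || (b != d) -> b != a.+1 ->
      (g a != g b) && ~~ e (g a) (g b).
    move=> /andP[ltab lebd] ab0d ba.
    have -> : g b = f (i + a + (b - a)) by rewrite -addnA subnKC // ltnW.
    apply: IHd; last by rewrite ltn_subRL addn1 ltn_neqAle eq_sym ba.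
    case/orP: ab0d => [|bd]; last first.
      by rewrite (leq_ltn_trans (leq_subr _ _)) // ltn_neqAle bd.
    rewrite -lt0n => a0; rewrite (leq_trans _ lebd) // ltn_subrL a0.
    exact: leq_ltn_trans ltab.
  have g_lt a b : a < b <= d -> g a != g b.
    move=> /[dup] ltabd /andP[ltab lebd].
    have [->|ba] := eqVneq b a.+1.
      by apply/eqP => gE; have := f_e (i + a); rewrite -addnS -/(g _) gE e_irr.
    have [a0|a0] := eqVneq a 0; last first.
      by have /andP[] := g_far a b ltabd (introT orP (or_introl a0)) ba.
    have [bd|bd] := eqVneq b d; first by rewrite a0 bd /g addn0.
    by have /andP[] := g_far a b ltabd (introT orP (or_intror bd)) ba.
  have uniq_c : uniq c.
    apply/mkseq_uniqP => a b; rewrite !inE !ltnS => ad bd gE.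
    case: (ltngtP a b) => // [ab|ba].
      by move: (g_lt a b); rewrite ab bd gE eqxx => /(_ isT).
    by move: (g_lt b a); rewrite ba ad gE eqxx => /(_ isT).
  have g_c a : a <= d -> g a \in c by move=> ad; rewrite map_f // mem_iota ltnS.
  have next_g a : a < d -> next c (g a) = g a.+1.
    move=> ad; rewrite next_nth (g_c _ (ltnW ad)).
    have -> : index (g a) c = a.
      rewrite -{1}(@nth_mkseq _ (g 0) g d.+1 a) ?ltnS ?(ltnW ad) //.
      by rewrite index_uniq ?size_mkseq ?ltnS ?(ltnW ad).
    have := @nth_mkseq _ (g 0) g d.+1 a.+1; rewrite ltnS => <- //.
  have next_last : next c (g d) = g 0.
    rewrite next_nth (g_c _ (leqnn d)).
    have -> : index (g d) c = d.
      rewrite -{1}(@nth_mkseq _ (g 0) g d.+1 d) ?ltnS //.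
      by rewrite index_uniq ?size_mkseq ?ltnS.
    (* [next] reads the tail of [c], of length [d], at index [d]; this is out of range, so the
       default, the head [g 0], closes the cycle. *)
    by rewrite /c /mkseq /= nth_default // size_map size_iota.
  have mem_c x : x \in c -> exists2 a, a <= d & x = g a.
    by case/mapP => a; rewrite mem_iota ltnS => ad ->; exists a.
  have c_gt3 : 3 < size c by rewrite size_mkseq.
  refine (chord c c_gt3 _); split.
    rewrite /ucycle uniq_c andbT; apply: cycle_from_next => // x /mem_c[a + ->].
    rewrite leq_eqVlt => /orP[/eqP->|ad].
      by rewrite next_last /g addn0 e_sym.
    by rewrite next_g // /g addnS.
  have chordless a b : a < b <= d -> e (g a) (g b) ->
      (g a == next c (g b)) || (g b == next c (g a)).
    move=> /[dup] ltabd /andP[ltab lebd] eab.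
    have [ba|ba] := eqVneq b a.+1.
      by rewrite [X in _ || (_ == X)]next_g -ba ?eqxx ?orbT.
    have [a0|a0] := eqVneq a 0; last first.
      by have /andP[_] := g_far a b ltabd (introT orP (or_introl a0)) ba;
         rewrite eab.
    have [bd|bd] := eqVneq b d; first by rewrite bd a0 next_last eqxx.
    by have /andP[_] := g_far a b ltabd (introT orP (or_intror bd)) ba;
       rewrite eab.
  move=> _ _ /mem_c[a ad ->] /mem_c[b bd ->] eab.
  case: (ltngtP a b) => [ab|ba|ab]; last by move: eab; rewrite ab e_irr.
    by rewrite orbC; apply: chordless; rewrite ?ab ?bd.
  by apply: chordless; rewrite ?ba ?ad // e_sym.
(* By [far] the walk never repeats a vertex, which is impossible in a finite graph. *)
have f_inj : injective f.
  suff f_lt a b : a < b -> f a != f b.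
    move=> a b fE; apply/eqP; rewrite eqn_leq (leqNgt a) (leqNgt b).
    by apply/andP; split; apply/negP => /f_lt; rewrite fE eqxx.
  move=> ab; have [->|ba] := eqVneq b a.+1.
    by apply/eqP => fE; have := f_e a; rewrite -fE e_irr.
  have ba1 : 1 < b - a by rewrite ltn_subRL addn1 ltn_neqAle eq_sym ba.
  by have /andP[] := far _ ba1 a; rewrite subnKC // ltnW.
have := leq_card (fun i : 'I_#|T|.+1 => f i) (inj_comp f_inj val_inj).
by rewrite card_ord ltnn.
Qed.

Lemma chordal_dominated_edge W x y :
  chordal e -> x \in W -> y \in W -> e x y ->
  exists u v, [/\ u \in W, v \in W, e u v
                & forall w, w \in W -> e u w -> (w == v) || e v w].
Proof.
move=> chord xW yW exy.
pose good (p : T * T) := [&& p.1 \in W, p.2 \in W & e p.1 p.2].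
pose cand (p : T * T) w := [&& w \in W, e p.2 w, w != p.1 & ~~ e p.1 w].
(* A pair holds the last two vertices of the walk. By [stepP] the default [p.1] is never taken at a
   good pair. *)
pose step p := (p.2, odflt p.1 [pick w | cand p w]).
have [/existsP[[u v] /and4P[/= uW vW euv /forall_inP dom]]|none] :=
  boolP [exists p : T * T, [&& p.1 \in W, p.2 \in W, e p.1 p.2
    & [forall w in W, e p.1 w ==> ((w == p.2) || e p.2 w)]]].
  by exists u, v; split=> // w wW euw; have := dom w wW; rewrite euw.
exfalso.
have stepP p : good p -> cand p (step p).2.
  case: p => a b /and3P[/= aW bW eab]; rewrite /step /=.
  (* Without a candidate, every neighbour of [b] in [W] is [a] or adjacent to [a], so the reversed
     edge is dominated. *)
  case: pickP => [w //|no]; case/negP: none; apply/existsP; exists (b, a).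
  rewrite /= aW bW e_sym eab; apply/forall_inP => w wW; apply/implyP => ebw.
  by have := no w; rewrite /cand /= wW ebw /= -negb_or => /negbFE.
have step_good p : good p -> good (step p).
  move=> /[dup] gp /and3P[_ p2W _]; case/and4P: (stepP p gp) => w1 w2 _ _.
  by rewrite /good w1 p2W.
pose P n := iter n step (x, y).
have goodP n : good (P n).
  by elim: n => [|n /step_good //]; rewrite /good /= xW yW.
apply: (@chordal_no_long_walk (fun n => (P n).1)) => // n.
- by case/and3P: (goodP n).
- by case/and4P: (stepP _ (goodP n)).
- by case/and4P: (stepP _ (goodP n)).
Qed.

(** * Independent sets of induced subgraphs *)

Definition indep_in W r : {set {set T}} :=
  [set A in indep_family e r | A \subset W].

(* "mu(G[W]) >= m", with the maximality of I expressed as domination. *)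
Definition mu_in_ge W m :=
  forall I, I \subset W -> independent e I ->
    (forall x, x \in W -> x \notin I -> exists2 y, y \in I & e x y) -> m <= #|I|.

Lemma independentP A :
  reflect {in A &, forall x y, ~~ e x y} (independent e A).
Proof.
apply: (iffP forall_inP) => [indA x y Ax|indA x Ax]; first exact: (forall_inP (indA x Ax)).
by apply/forall_inP => y; apply: indA.
Qed.

Lemma independentS A B : A \subset B -> independent e B -> independent e A.
Proof.
move=> /subsetP sAB /independentP indB; apply/independentP => x y Ax Ay.
by rewrite indB ?sAB.
Qed.

Lemma independentU1 x A :
  independent e A -> (forall y, y \in A -> ~~ e x y) -> independent e (x |: A).
Proof.
move=> /independentP indA xA; apply/independentP => y z.
case/setU1P => [->|Ay] /setU1P[->|Az]; rewrite ?e_irr ?xA //.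
  by rewrite e_sym xA.
exact: indA.
Qed.

Lemma indep_inP W r A :
  reflect [/\ independent e A, #|A| = r & A \subset W] (A \in indep_in W r).
Proof.
rewrite !inE -andbA.
by apply: (iffP and3P) => -[? /eqP ? ?].
Qed.

Lemma indep_in_edgeless W r :
  {in W &, forall x y, ~~ e x y} ->
  indep_in W r = [set A : {set T} | A \subset W & #|A| == r].
Proof.
move=> /independentP indW; apply/setP => A; rewrite !inE -andbA [RHS]andbC.
by have [sAW|_] := boolP (A \subset W); rewrite ?andbF ?(independentS sAW).
Qed.

Lemma mu_in_ge_mu : mu_in_ge [set: T] (mu e).
Proof.
move=> I _ indI domI; apply: mu_le; apply/maxsetP; split=> // B indB sIB.
apply/eqP; rewrite eq_sym eqEsubset sIB; apply/subsetP => x Bx.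
apply/negPn/negP => /(domI x (in_setT x))[y Iy].
by apply/negP/(independentP _ indB); rewrite // (subsetP sIB).
Qed.

(** * Deleting [v] or its closed neighbourhood, where N[u] lies in N[v] within [W] *)

Section Split.

Variables (W : {set T}) (u v : T).
Hypotheses (uW : u \in W) (vW : v \in W) (euv : e u v).
Hypothesis dom : forall w, w \in W -> e u w -> (w == v) || e v w.

Let V0 := W :\ v.
Let V1 := [set w in V0 | ~~ e v w].

Let neq_uv : u != v.
Proof. by apply/eqP => uv; have := euv; rewrite uv e_irr. Qed.

(** A set [I] dominating [V0] also dominates [v]: either [u] is in [I], or the neighbour of [u] in
    [I] is adjacent to [v] too. *)
Lemma mu_in_ge_delete m : mu_in_ge W m -> mu_in_ge V0 m.
Proof.
move=> muW I sI indI domI; apply: muW => // [|x xW xI].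
  exact: subset_trans sI (subsetDl _ _).
have [->|xv] := eqVneq x v; last by apply: domI; rewrite // !inE xv.
have [Iu|nIu] := boolP (u \in I); first by exists u; rewrite // e_sym.
have [|y Iy euy] := domI u _ nIu; first by rewrite !inE neq_uv.
have /setD1P[yv yW] := subsetP sI y Iy.
by exists y; move: (dom yW euy); rewrite ?(negPf yv).
Qed.

(** Adding [v] to a dominating independent set of [V1] gives one of [W]. *)
Lemma mu_in_ge_link m : mu_in_ge W m.+1 -> mu_in_ge V1 m.
Proof.
move=> muW I sI indI domI.
have IP x : x \in I -> [/\ x != v, x \in W & ~~ e v x].
  by move/(subsetP sI); rewrite !inE -andbA => /and3P.
rewrite -ltnS; have nIv : v \notin I by apply/negP => /IP[/eqP].
have <- : #|v |: I| = #|I|.+1 by rewrite cardsU1 nIv.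
apply: muW.
- by apply/subsetP => x /setU1P[->|/IP[]].
- by apply: independentU1 => // y /IP[].
move=> x xW; rewrite !inE negb_or => /andP[xv xI].
have [evx|nevx] := boolP (e v x); first by exists v; rewrite ?setU11 // e_sym.
have [|y Iy exy] := domI x _ xI; first by rewrite !inE xv xW.
by exists y; rewrite ?inE ?Iy ?orbT.
Qed.

(** Sets avoiding [v] lie in [V0]; adding [v] maps the independent sets of [V1] injectively to sets
    through [v]. *)
Lemma card_indep_in_split r :
  #|indep_in V0 r.+1| + #|indep_in V1 r| <= #|indep_in W r.+1|.
Proof.
have V1P A : A \in indep_in V1 r -> v \notin A.
  by case/indep_inP => _ _ /subsetP sA; apply/negP => /sA; rewrite !inE eqxx.
have inj : {in indep_in V1 r &, injective (fun A => v |: A)}.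
  by move=> A B /V1P vA /V1P vB eAB; rewrite -(setU1K vA) eAB setU1K.
rewrite -(card_in_imset inj) -(cardsID [set A : {set T} | v \in A] (indep_in W _)) addnC.
apply: leq_add; apply/subset_leq_card/subsetP.
  move=> _ /imsetP[A /[dup] /V1P vA /indep_inP[indA cA sA] ->].
  rewrite inE [X in _ && X]inE setU11 andbT; apply/indep_inP; split.
  - apply: independentU1 => // y /(subsetP sA).
    by rewrite !inE => /andP[].
  - by rewrite cardsU1 vA cA.
  - by apply/subsetP => x /setU1P[->//|/(subsetP sA)]; rewrite !inE -andbA => /and3P[].
move=> A /indep_inP[indA cA]; rewrite subsetD1 => /andP[sA vA].
by rewrite 2!inE vA; apply/indep_inP.
Qed.

(** * Shifting [v] to [u] *)

Let sh A := u |: (A :\ v).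

(* The families of the members without and with v once v has been shifted to u;
   in the second one, v is removed from each member. *)
Definition shift_del F := [set A in F | v \notin A]
  :|: sh @: [set A in F | (v \in A) && (sh A \notin F)].
Definition shift_link F :=
  (fun A => A :\ v) @: [set A in F | (v \in A) && (sh A \in F)].

Let indep_notin A : independent e A -> v \in A -> u \notin A.
Proof.
move=> /independentP indA vA; apply/negP => uA.
by have := indA u v uA vA; rewrite euv.
Qed.

(** Members through [v] miss [u], so [sh] is injective on them. The two halves of [shift_del F] are
    disjoint, since the shifted sets kept there lie outside [F]. *)
Lemma card_shift F r : F \subset indep_in W r ->
  #|F| = #|shift_del F| + #|shift_link F|.
Proof.
move=> sF.
have FP A : A \in F -> v \in A -> u \notin A.
  by move=> /(subsetP sF)/indep_inP[/indep_notin].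
have inj : {in [set A in F | v \in A] &, injective sh}.
  move=> A B /setIdP[FA vA] /setIdP[FB vB] shAB.
  have shK C : C \in F -> v \in C -> v |: (sh C :\ u) = C.
    by move=> FC vC; rewrite setU1K ?setD1K // !inE (negPf (FP C FC vC)) andbF.
  by rewrite -(shK A) // shAB shK.
rewrite cardsU card_in_imset; last first.
  move=> A B /setIdP[FA /andP[vA _]] /setIdP[FB /andP[vB _]].
  by apply: inj; apply/setIdP.
rewrite card_in_imset; last first.
  move=> A B /setIdP[_ /andP[vA _]] /setIdP[_ /andP[vB _]] AB.
  by rewrite -(setD1K vA) AB setD1K.
set I := _ :&: _; have -> : I = set0.
  apply/setP => A; rewrite !inE; apply/negP => /andP[/andP[FA _]].
  by case/imsetP => B /setIdP[_ /andP[_ nF]] AE; rewrite -AE FA in nF.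
rewrite cards0 subn0 -addnA [X in _ + X]addnC.
rewrite -(cardsID [set A : {set T} | v \in A] F) addnC; congr (_ + _).
  by apply: eq_card => A; rewrite !inE andbC.
rewrite -(cardsID [set A : {set T} | sh A \in F]); congr (_ + _).
  by apply: eq_card => A; rewrite !inE andbA.
by apply: eq_card => A; rewrite !inE andbC andbA.
Qed.

(** [sh A] stays independent: a neighbour of [u] in [A] other than [v] would be adjacent to [v],
    which is in [A]. *)
Lemma shift_del_sub F r :
  F \subset indep_in W r -> shift_del F \subset indep_in V0 r.
Proof.
move=> sF; apply/subsetP => A.
case/setUP => [/setIdP[FA vA]|/imsetP[{}A /setIdP[FA /andP[vA _]] ->]].
  have /indep_inP[indA cA sA] := subsetP sF _ FA.
  by apply/indep_inP; split; rewrite // subsetD1 sA.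
have /indep_inP[indA cA sA] := subsetP sF _ FA.
apply/indep_inP; split.
- apply: independentU1; first exact: independentS (subsetDl _ _) indA.
  move=> y /setD1P[yv yA]; apply/negP => /(dom (subsetP sA y yA)).
  rewrite (negPf yv) /=; exact/negP/(independentP _ indA).
- rewrite cardsU1 !inE (negPf (indep_notin indA vA)) andbF -cA.
  by rewrite (cardsD1 v A) vA.
- apply/subsetP => x /setU1P[->|]; first by rewrite !inE neq_uv.
  by rewrite !inE => /andP[-> /(subsetP sA)].
Qed.

Lemma shift_link_sub F r :
  F \subset indep_in W r.+1 -> shift_link F \subset indep_in V1 r.
Proof.
move=> sF; apply/subsetP => _ /imsetP[A /setIdP[FA /andP[vA _]] ->].
have /indep_inP[indA cA sA] := subsetP sF _ FA.
apply/indep_inP; split; first exact: independentS (subsetDl _ _) indA.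
  by move: cA; rewrite (cardsD1 v) vA => -[].
apply/subsetP => x; rewrite !inE => /andP[-> xA].
by rewrite (subsetP sA) //= (independentP _ indA).
Qed.

(** Two shifted sets share [u]. If [A] avoids [v], a common point of [A] and [B] differs from [v]
    and survives in [sh B]. *)
Lemma shift_del_meet FA FB :
  cross_meet FA FB -> cross_meet (shift_del FA) (shift_del FB).
Proof.
have mixed F1 F2 A B : cross_meet F1 F2 -> A \in F1 -> v \notin A ->
    B \in F2 -> A :&: sh B != set0.
  move=> meet F1A vA F2B; have /set0Pn[x /setIP[xA xB]] := meet _ _ F1A F2B.
  apply/set0Pn; exists x; rewrite !inE xA xB andbT orbC.
  by have [xv|//] := eqVneq x v; rewrite -xv xA in vA.
move=> meet A B /setUP[/setIdP[FAA vA]|/imsetP[{}A /setIdP[FAA _] ->]]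
  /setUP[/setIdP[FBB vB]|/imsetP[{}B /setIdP[FBB _] ->]].
- exact: meet.
- exact: mixed meet _ _ _.
- by rewrite setIC; apply: mixed (cross_meetC meet) _ _ _.
- by apply/set0Pn; exists u; rewrite inE !setU11.
Qed.

(** Here [sh A] itself belongs to [FA], so it meets [B]. The common point is not [u], since [B]
    contains [v], and not [v], so it lies in both [A :\ v] and [B :\ v]. *)
Lemma shift_link_meet FA FB r : FB \subset indep_in W r ->
  cross_meet FA FB -> cross_meet (shift_link FA) (shift_link FB).
Proof.
move=> sFB meet _ _ /imsetP[A /setIdP[_ /andP[_ shA]] ->]
  /imsetP[B /setIdP[FBB /andP[vB _]] ->].
have /indep_inP[indB _ _] := subsetP sFB _ FBB.
have /set0Pn[x /setIP[/setU1P[->|xA] xB]] := meet _ _ shA FBB.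
  by rewrite (negPf (indep_notin indB vB)) in xB.
apply/set0Pn; exists x; rewrite inE xA; move: xA.
by rewrite !inE xB => /andP[->].
Qed.

End Split.

(** * Induction on the number of vertices *)

Lemma cross_meet_indep_in W r FA FB :
  chordal e -> mu_in_ge W (2 * r) ->
  FA \subset indep_in W r -> FB \subset indep_in W r -> cross_meet FA FB ->
  #|FA| + #|FB| <= #|indep_in W r|.
Proof.
move=> chord.
have [n] := ubnP #|W|; elim: n => // n IHn in W r FA FB * => /ltnSE leWn.
move=> muW sFA sFB meet.
have [/exists_inP[x xW /exists_inP[y yW exy]]|edgeless] :=
  boolP [exists x in W, exists y in W, e x y]; last first.
  have edgelessW : {in W &, forall x y, ~~ e x y}.
    move=> x y xW yW; apply: contra edgeless => exy.
    by apply/exists_inP; exists x => //; apply/exists_inP; exists y.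
  rewrite (indep_in_edgeless _ edgelessW) in sFA sFB *.
  (* [W] is itself independent and vacuously dominating, hence [2 * r <= #|W|]. *)
  apply: cross_meet_draws => //; apply: muW => // [|x xW /negP//].
  exact/independentP.
(* For [r = 0] a common member would be the empty set, which does not meet itself; so the families
   are disjoint. *)
case: r => [|r] in muW sFA sFB *.
  rewrite -cardsUI; suff -> : FA :&: FB = set0.
    by rewrite cards0 addn0 subset_leq_card // subUset sFA.
  apply/setP => A; rewrite !inE; apply/negP => /andP[FAA FBA].
  have := meet A A FAA FBA; rewrite setIid -card_gt0.
  by have /indep_inP[_ ->] := subsetP sFA A FAA.
have [u [v [uW vW euv dom]]] := chordal_dominated_edge chord xW yW exy.
have ltWv : #|W :\ v| < n.
  by apply: leq_trans leWn; rewrite [ltnRHS](cardsD1 v) vW.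
rewrite (card_shift euv sFA) (card_shift euv sFB) addnACA.
apply: leq_trans (card_indep_in_split vW r); apply: leq_add.
  apply: IHn => //.
  - exact: (mu_in_ge_delete uW euv dom muW).
  - exact: shift_del_sub.
  - exact: shift_del_sub.
  - exact: shift_del_meet.
apply: IHn => //.
- by apply: leq_ltn_trans ltWv; apply/subset_leq_card/subsetP => w /setIdP[].
(* Lowering [r] by one leaves room for a loss of two in the bound; the link loses only one. *)
- apply: mu_in_ge_link => // I sI indI domI.
  by apply: leq_trans (muW I sI indI domI); rewrite mulnS.
- exact: shift_link_sub.
- exact: shift_link_sub.
- exact: shift_link_meet sFB meet.
Qed.

End ChordalCrossIntersecting.

Theorem theorem1p7 (T : finType) (e : rel T)
    (e_sym : symmetric e) (e_irr : irreflexive e)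
    (e_chordal : chordal e)
    (r : nat) (r_ge1 : 1 <= r) (r_le : 2 * r <= mu e)
    (FA FB : {set {set T}}) (FAB : cross_intersecting e r FA FB) :
  #|FA| + #|FB| <= #|indep_family e r|.
Proof.
have -> : indep_family e r = indep_in e [set: T] r.
  by apply/setP => A; rewrite !inE subsetT andbT.
case: FAB => sFA sFB meet; apply: cross_meet_indep_in => //.
- by move=> I sI indI /(mu_in_ge_mu sI indI); apply: leq_trans.
- by apply: subset_trans sFA _; apply/subsetP => A; rewrite !inE subsetT andbT.
- by apply: subset_trans sFB _; apply/subsetP => A; rewrite !inE subsetT andbT.
Qed.
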